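(* For all $x\in\mathbb{R}^d$, $$V_0(x)=\overline{V}_0(x)=\tilde V_0(x).$$
   Context: Let $N\ge 1$, let $A\subset\mathbb{R}^{n_A}$ and $B\subset\mathbb{R}^{n_B}$ ($n_A,n_B\ge1$) be non-empty compact sets, let $F:\mathbb{R}^d\times A\times B\to\mathbb{R}^d$ be continuous, and let $g,\varphi:\mathbb{R}^d\to\mathbb{R}$ be Lipschitz continuous. Write $p\vee q=\max(p,q)$ and let $\mathrm{Meas}(X,Y)$ denote the set of Borel measurable functions from $X$ to $Y$. For $a=(a_0,\dots,a_{N-1})\in A^N$, $b=(b_0,\dots,b_{N-1})\in B^N$ and $x\in\mathbb{R}^d$, define $X^{a,b}_{0,x}=x$, $X^{a,b}_{k+1,x}=F(X^{a,b}_{k,x},a_k,b_k)$, and $$J_0(x,a,b)=\Big(\max_{0\le k\le N-1}g(X^{a,b}_{k,x})\Big)\vee\varphi(X^{a,b}_{N,x}).$$ $S_N$ is the set of discrete non-anticipative strategies: measurable functions $\alpha:B^N\to A^N$ such that, for every $0\le k\le N-1$, the component $\alpha_k$ depends only on $(b_0,\dots,b_k)$. Define $$V_0(x)=\inf_{\alpha\in S_N}\sup_{b\in B^N}J_0(x,\alpha[b],b),$$ $$\overline V_0(x)=\max_{b_0\in B}\min_{a_0\in A}\cdots\max_{b_{N-1}\in B}\min_{a_{N-1}\in A}J_0(x,a,b).$$ Let $\mathcal{G}=\mathrm{Meas}(\mathbb{R}^d\times B,A)$. For $\alpha=(\alpha_0,\dots,\alpha_{N-1})\in\mathcal{G}^N$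 and $b\in B^N$ let $\tilde x_0=x$, $\tilde x_{k+1}=F(\tilde x_k,\alpha_k(\tilde x_k,b_k),b_k)$, and $$\tilde J_0(x,\alpha[b],b)=\Big(\max_{0\le k\le N-1}g(\tilde x_k)\Big)\vee\varphi(\tilde x_N),\qquad \tilde V_0(x)=\inf_{\alpha\in\mathcal{G}^N}\sup_{b\in B^N}\tilde J_0(x,\alpha[b],b).$$ *)

(* Defs.v *)
From HB Require Import structures.
From mathcomp Require Import all_boot all_order all_algebra.
From mathcomp Require Import all_classical all_reals all_analysis.
Import Order.TTheory GRing.Theory Num.Theory.
Import numFieldNormedType.Exports.

Set Implicit Arguments.
Unset Strict Implicit.
Unset Printing Implicit Defensive.

Local Open Scope classical_set_scope.
Local Open Scope ring_scope.

(* Spaces R^m are row vectors 'rV[R]_m, and (R^m)^N is 'M[R]_(N, m), the k-th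
   component of a sequence b being row k b. Both carry the library's product
   topology. A function between subsets is represented by a function on the
   ambient spaces together with a condition that it maps one subset into the
   other; its values outside the domain are never used. *)

(* Provides the pointed topological structure of binary products, which the
   library leaves undeclared and borel_fun needs. *)
HB.saturate prod.

(* Measurability on D is w.r.t. the trace on D of the Borel sigma-algebra of X.
   measurable_fun is vacuous when D is not Borel; here D is always closed. *)
Definition borel_fun (X Y : ptopologicalType) (D : set X) (f : X -> Y) : Prop :=
  @measurable_fun _ _ (g_sigma_algebraType (@open X))
    (g_sigma_algebraType (@open Y)) D f.

(* Greatest and least elements, i.e. attained extrema; 0 if there is none. *)
Definition set_max (R : realType) (S : set R) : R :=
  xget 0 (S `&` [set m | ubound S m]).

Definition set_min (R : realType) (S : set R) : R :=
  xget 0 (S `&` [set m | lbound S m]).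

(* S^N *)
Definition seqs (R : realType) (N m : nat) (S : set 'rV[R]_m) :
    set 'M[R]_(N, m) :=
  [set s | forall k : 'I_N, S (row k s)].

(* x_0 = x and x_{k+1} = step k x_k for k < N; the sequence is frozen from
   rank N on, where it is never used. *)
Fixpoint orbit_to (T : Type) (N : nat) (step : 'I_N -> T -> T) (x : T)
    (k : nat) : T :=
  if k is k'.+1 then
    let y := orbit_to step x k' in
    if insub k' is Some i then step i y else y
  else x.

(* The iterated max is seeded with its own term of rank 0, since R has no least
   element; this is harmless for N >= 1. *)
Definition cost (R : realType) (d N : nat) (g phi : 'rV[R]_d -> R)
    (X : nat -> 'rV[R]_d) : R :=
  Num.max (\big[Num.max/g (X 0%N)]_(k < N) g (X k)) (phi (X N)).

(* max_{b_0} min_{a_0} ... max_{b_{n-1}} min_{a_{n-1}} Phi a b *)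
Fixpoint maxmin (R : realType) (nA nB : nat) (A : set 'rV[R]_nA)
    (B : set 'rV[R]_nB) (n : nat) :
    ('M[R]_(n, nA) -> 'M[R]_(n, nB) -> R) -> R :=
  match n with
  | 0 => fun Phi => Phi 0 0
  | n'.+1 => fun Phi =>
      set_max [set set_min [set @maxmin R nA nB A B n'
                  (fun a b => Phi (col_mx a0 a) (col_mx b0 b)) | a0 in A]
              | b0 in B]
  end.

Section Game.
Context (R : realType) (N d nA nB : nat).
Context (A : set 'rV[R]_nA) (B : set 'rV[R]_nB).
Context (F : 'rV[R]_d * 'rV[R]_nA * 'rV[R]_nB -> 'rV[R]_d).
Context (g phi : 'rV[R]_d -> R).

Definition traj (x : 'rV[R]_d) (a : 'M[R]_(N, nA)) (b : 'M[R]_(N, nB)) :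
    nat -> 'rV[R]_d :=
  orbit_to (fun k y => F (y, row k a, row k b)) x.

Definition J0 (x : 'rV[R]_d) (a : 'M[R]_(N, nA)) (b : 'M[R]_(N, nB)) : R :=
  cost N g phi (traj x a b).

Definition nonanticipative (alpha : 'M[R]_(N, nB) -> 'M[R]_(N, nA)) : Prop :=
  forall (k : 'I_N) (b b' : 'M[R]_(N, nB)), seqs B b -> seqs B b' ->
    (forall j : 'I_N, (j <= k)%N -> row j b = row j b') ->
    row k (alpha b) = row k (alpha b').

Definition strategies : set ('M[R]_(N, nB) -> 'M[R]_(N, nA)) :=
  [set alpha | [/\ forall b, seqs B b -> seqs A (alpha b),
                   borel_fun (seqs B) alpha &
                   nonanticipative alpha]].

Definition V0 (x : 'rV[R]_d) : \bar R :=
  ereal_inf [set ereal_sup [set (J0 x (alpha b) b)%:E | b in seqs B]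
            | alpha in strategies].

Definition Vbar0 (x : 'rV[R]_d) : R := maxmin A B (J0 x).

(* Meas(R^d x B, A) *)
Definition feedbacks : set ('rV[R]_d * 'rV[R]_nB -> 'rV[R]_nA) :=
  [set f | (forall y b, B b -> A (f (y, b))) /\
           borel_fun ([set: 'rV[R]_d] `*` B) f].

Definition ftraj (x : 'rV[R]_d)
    (alpha : 'I_N -> 'rV[R]_d * 'rV[R]_nB -> 'rV[R]_nA)
    (b : 'M[R]_(N, nB)) : nat -> 'rV[R]_d :=
  orbit_to (fun k y => F (y, alpha k (y, row k b), row k b)) x.

Definition Jtilde0 (x : 'rV[R]_d)
    (alpha : 'I_N -> 'rV[R]_d * 'rV[R]_nB -> 'rV[R]_nA)
    (b : 'M[R]_(N, nB)) : R :=
  cost N g phi (ftraj x alpha b).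

Definition Vtilde0 (x : 'rV[R]_d) : \bar R :=
  ereal_inf [set ereal_sup [set (Jtilde0 x alpha b)%:E | b in seqs B]
            | alpha in [set al | forall k : 'I_N, feedbacks (al k)]].

End Game.

(* Main.v *)
Require Import Defs.
From HB Require Import structures.
From mathcomp Require Import finmap all_boot all_order all_algebra.
From mathcomp Require Import all_classical all_reals all_analysis.
From mathcomp Require Import lra.
Import Order.TTheory GRing.Theory Num.Theory.
Import numFieldNormedType.Exports.

Local Open Scope classical_set_scope.
Local Open Scope ring_scope.

(* Let w_0 = phi and w_{n+1}(y) = g(y) \/ max_b min_a w_n(F(y,a,b)). Minimum
   and maximum over a compact parameter preserve continuity, so every w_n is
   continuous, all the extrema are attained, and the iterated max-min is
   g(x) \/ w_N(x). Against any non-anticipative strategy, measurable or not, an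
   opponent who maximizes min_a w_{N-k-1}(F(x_k,a,b)) at each step k forces a
   cost of at least w_N(x); a feedback induces a non-anticipative strategy, so
   this bounds both V0 and Vtilde0 from below.

   For the upper bounds no exact measurable selection is needed, since V0 and
   Vtilde0 are infima: the feedback playing the first eps-optimal element of a
   dense sequence of A is Borel because it is countably valued, it loses at most
   N eps, and the strategy it induces is Borel as well. *)

(** * Continuity relative to a subset, and of extrema over a compact parameter *)

Lemma within_continuous_mapsto {X Y Z : topologicalType} (D : set X)
    (E : set Y) (f : X -> Y) (h : Y -> Z) :
  (forall x, D x -> E (f x)) -> {within D, continuous f} ->
  {within E, continuous h} -> {within D, continuous (h \o f)}.
Proof.
move=> DE /subspace_continuousP cf /subspace_continuousP ch.
apply/subspace_continuousP => x Dx.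
apply: (cvg_trans _ (ch _ (DE _ Dx))) => U /= hU.
have := cf _ Dx _ hU; rewrite /fmap /within /= !nbhs_simpl /=.
by apply: filterS => z hz Dz; apply: hz => //; exact: DE.
Qed.

Lemma within_continuous_pair {X Y Z : topologicalType} (D : set X)
    (f : X -> Y) (h : X -> Z) :
  {within D, continuous f} -> {within D, continuous h} ->
  {within D, continuous (fun x => (f x, h x))}.
Proof. by move=> cf ch x; apply: cvg_pair; [exact: cf | exact: ch]. Qed.

Section Marginal.
Context {R : realType} {X Y : topologicalType}.

(** Above: a minimizer [a] at [x] remains a competitor at nearby [x'], so
    [m x' <= h (x', a) < m x + e]. Below: around each [a] in [K], [h] exceeds [m x - e], and
    compactness of [K] gives one neighbourhood of [x] that serves all [a]. *)
Lemma marginal_min_continuous (D : set X) (K : set Y) (h : X * Y -> R)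
    (m : X -> R) :
  compact K -> {within D `*` K, continuous h} ->
  (forall x, D x -> exists2 a, K a & m x = h (x, a)) ->
  (forall x a, D x -> K a -> m x <= h (x, a)) ->
  {within D, continuous m}.
Proof.
move=> /compact_near_coveringP/near_covering_withinP cK.
move=> /subspace_continuousP ch hm lem.
apply/subspace_continuousP => x Dx.
apply/cvgrPdist_lt => e e0.
have near_h a : K a -> \forall x' \near x & a' \near a, D x' -> K a' ->
    `|h (x, a) - h (x', a')| < e.
  move=> Ka; have /cvgrPdist_lt/(_ e e0) := ch (x, a) (conj Dx Ka).
  rewrite /within /= => -[[U V] /= [Ux Va] UV].
  by exists (U, V) => //= -[x' a'] /= UVxa Dx' Ka'; exact: (UV (x', a')).
have low : \forall x' \near within D (nbhs x),
    K `<=` (fun a => m x - e < h (x', a)).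
  apply: cK => a Ka; have := near_h _ Ka => -[[U V] /= [Ux Va] UV].
  exists (V, D `&` U) => /=.
    by split => //; rewrite /within /=; apply: filterS Ux => z Uz Dz.
  move=> [a' x'] /= [Va' [Dx' Ux']] Ka'.
  have := UV (x', a') (conj Ux' Va') Dx' Ka'.
  rewrite /= ltr_distlC => /andP[+ _].
  have := lem x a Dx Ka; lra.
have [a Ka ma] := hm x Dx.
have up : \forall x' \near within D (nbhs x), m x' < m x + e.
  have := near_h a Ka => -[[U V] /= [Ux Va] UV].
  rewrite /within /=; apply: filterS Ux => x' Ux' Dx'.
  have := UV (x', a) (conj Ux' (nbhs_singleton Va)) Dx' Ka.
  rewrite /= ltr_distlC ma => /andP[_]; apply: le_lt_trans; exact: lem.
near=> x'.
have Dx' : D x' by near: x'; exact: withinT.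
have [a' Ka' ma'] := hm x' Dx'.
rewrite /from_subspace ltr_distlC; apply/andP; split; last by near: x'.
rewrite ma'; have : K `<=` (fun a => m x - e < h (x', a)) by near: x'.
by apply.
Unshelve. all: by end_near. Qed.

Lemma marginal_max_continuous (D : set X) (K : set Y) (h : X * Y -> R)
    (m : X -> R) :
  compact K -> {within D `*` K, continuous h} ->
  (forall x, D x -> exists2 a, K a & m x = h (x, a)) ->
  (forall x a, D x -> K a -> h (x, a) <= m x) ->
  {within D, continuous m}.
Proof.
move=> cK ch hm lem.
suff cm : {within D, continuous (fun x => - m x)}.
  have -> : m = (fun x => - - m x) by apply/funext => x; rewrite opprK.
  by move=> x; apply: cvgN; exact: cm.
apply: (@marginal_min_continuous D K (fun p => - h p) _ cK).
- by move=> x; apply: cvgN; exact: ch.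
- by move=> x /hm[a Ka ->]; exists a.
- by move=> x a Dx Ka; rewrite lerN2; exact: lem.
Qed.

Lemma set_min_attained (K : set Y) (f : Y -> R) :
  K !=set0 -> compact K -> {within K, continuous f} ->
  (exists2 a, K a & set_min [set f a | a in K] = f a) /\
  (forall a, K a -> set_min [set f a | a in K] <= f a).
Proof.
move=> K0 cK cf; have [c /[!inE] Kc fc] := compact_EVT_min K0 cK cf.
(* The extreme value theorem exhibits the least element [f c], so the default 0 of [xget] never
   occurs. *)
rewrite /set_min; case: xgetP => [m -> [[a Ka <-] lm]|/(_ (f c)) []].
  by split; [exists a | move=> b Kb; apply: lm; exists b].
split; first by exists c.
by move=> _ [a Ka <-]; apply: fc; rewrite inE.
Qed.

Lemma set_max_attained (K : set Y) (f : Y -> R) :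
  K !=set0 -> compact K -> {within K, continuous f} ->
  (exists2 a, K a & set_max [set f a | a in K] = f a) /\
  (forall a, K a -> f a <= set_max [set f a | a in K]).
Proof.
move=> K0 cK cf; have [c /[!inE] Kc fc] := compact_EVT_max K0 cK cf.
rewrite /set_max; case: xgetP => [m -> [[a Ka <-] lm]|/(_ (f c)) []].
  by split; [exists a | move=> b Kb; apply: lm; exists b].
split; first by exists c.
by move=> _ [a Ka <-]; apply: fc; rewrite inE.
Qed.

End Marginal.

Lemma set_minE {R : realType} (S : set R) (m : R) :
  S m -> lbound S m -> set_min S = m.
Proof.
move=> Sm lm; rewrite /set_min; case: xgetP => [m' -> [Sm' lm']|/(_ m) []//].
by apply/eqP; rewrite eq_le (lm _ Sm') (lm' _ Sm).
Qed.

Lemma set_maxE {R : realType} (S : set R) (m : R) :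
  S m -> ubound S m -> set_max S = m.
Proof.
move=> Sm lm; rewrite /set_max; case: xgetP => [m' -> [Sm' lm']|/(_ m) []//].
by apply/eqP; rewrite eq_le (lm _ Sm') (lm' _ Sm).
Qed.

(** * Lipschitz functions, rows, and dense sequences in compact sets *)

Lemma lipschitz_continuous {R : realType} {V : normedModType R}
    (f : V -> R) : lipschitz (f : V -> R^o) -> continuous f.
Proof.
move=> [M [_ /(_ (Num.max M 1 + 1))]].
(* The Lipschitz bound is given for all constants above some [M] of unknown sign; this one exceeds
   [M] and is positive, so [e] can be divided by it. *)
have k0 : 0 < Num.max M 1 + 1 by rewrite ltr_wpDl// le_max ler01 orbT.
set k := Num.max M 1 + 1 in k0 *.
have Mk : M < k by rewrite /k; rewrite ltr_pwDr// le_max lexx.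
move=> /(_ Mk) lf x; apply/cvgrPdist_lt => e e0.
near=> y.
apply: le_lt_trans (lf (x, y) (conj I I)) _ => /=.
rewrite mulrC -ltr_pdivlMr//; near: y.
by apply: (@cvgr_dist_lt _ _ _ _ _ id); rewrite ?divr_gt0//; exact: cvg_id.
Unshelve. all: by end_near. Qed.

Lemma row_continuous {R : realType} (m n : nat) (k : 'I_m) :
  continuous (row k : 'M[R]_(m, n) -> 'rV[R]_n).
Proof.
move=> M U /= /(nbhs_ballP (row k M)) [e e0 eU].
apply/nbhs_ballP; exists e => //= M' [_ MM']; apply: eU; split => // i j.
by rewrite !mxE.
Qed.

(** For each [i], finitely many balls of radius [i.+1%:R^-1] centred in [K] cover [K]. The set [C]
    of all these centres is countable and non-empty, so a sequence enumerates it. *)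
Lemma countable_dense_seq {R : realType} {m n : nat} (K : set 'M[R]_(m, n)) :
  K !=set0 -> compact K ->
  exists s : nat -> 'M[R]_(m, n), (forall i, K (s i)) /\
    forall a U, K a -> nbhs a U -> exists i, U (s i).
Proof.
move=> K0; rewrite compact_cover => cK.
have fin i : exists D : set 'M[R]_(m, n), [/\ finite_set D, D `<=` K &
    K `<=` cover D (fun z : 'M[R]_(m, n) => (ball z i.+1%:R^-1)°)].
  have [||D' D'K covD'] := cK 'M[R]_(m, n) K (fun z => (ball z i.+1%:R^-1)°).
  - by move=> z _; exact: open_interior.
  - by move=> z Kz; exists z => //; apply: nbhsx_ballx; rewrite invr_gt0.
  exists [set` D']; split => //; first exact: finite_fset.
  by move=> z /= /D'K; rewrite inE.
have [D HD] := choice fin.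
pose C := \bigcup_i D i.
have CK : C `<=` K by move=> z [i _]; have [_ + _] := HD i; apply.
have [/eqP|[s]] : C = set0 \/ $|{surjfun [set: nat] >-> C}|.
- apply/pfcard_geP; apply: bigcup_countable => // i _.
  by apply: finite_set_countable; have [] := HD i.
- move=> C0; exfalso; case: K0 => a Ka; have [_ _ /(_ a Ka)[z Dz _]] := HD 0%N.
  by move/eqP: C0; rewrite -subset0 => /(_ z); apply; exists 0%N.
exists s; split => [i|a U Ka /nbhs_ballP[e /= e0 aU]].
  by apply: CK; exact: funS.
have [i ie] : exists i, i.+1%:R^-1 < e.
  have [//|j] := @ltr_add_invr R 0 e; by rewrite add0r => ?; exists j.
have [_ _ /(_ a Ka)[z Dz /= /interior_subset za]] := HD i.
have Cz : C z by exists i.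
have [j _ sj] := @surj _ _ _ _ s z Cz; exists j.
rewrite sj; apply: aU; apply: ball_sym; exact: le_ball (ltW ie) _ za.
Qed.

(** * Finite sequences split into head and tail *)

Section Sequences.
Context {R : realType} {m : nat}.

Lemma row_cons0 n (u : 'rV[R]_m) (M : 'M[R]_(n, m)) :
  row (ord0 : 'I_n.+1) (col_mx u M) = u.
Proof.
have -> : (ord0 : 'I_n.+1) = lshift n (ord0 : 'I_1) by exact: val_inj.
by rewrite (@rowKu _ 1) row_id.
Qed.

Lemma row_consS n (u : 'rV[R]_m) (M : 'M[R]_(n, m)) (k : 'I_n) :
  row (lift ord0 k : 'I_n.+1) (col_mx u M) = row k M.
Proof.
have -> : (lift ord0 k : 'I_n.+1) = rshift 1 k by exact: val_inj.
by rewrite (@rowKd _ 1).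
Qed.

Lemma row_behead n (M : 'M[R]_(n.+1, m)) (k : 'I_n) :
  row k (row' ord0 M) = row (lift ord0 k) M.
Proof. by apply/rowP => j; rewrite !mxE. Qed.

Lemma cons_behead n (M : 'M[R]_(n.+1, m)) :
  col_mx (row ord0 M) (row' ord0 M) = M.
Proof.
apply/row_matrixP => k; case: (unliftP ord0 k) => [j|] ->.
  by rewrite row_consS row_behead.
by rewrite row_cons0.
Qed.

Lemma seqs_cons n (S : set 'rV[R]_m) (u : 'rV[R]_m) (M : 'M[R]_(n, m)) :
  S u -> seqs S M -> @seqs R n.+1 m S (col_mx u M).
Proof.
move=> Su SM k; case: (unliftP ord0 k) => [j|] ->.
  by rewrite row_consS; exact: SM.
by rewrite row_cons0.
Qed.

Lemma seqs_behead n (S : set 'rV[R]_m) (M : 'M[R]_(n.+1, m)) :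
  seqs S M -> @seqs R n m S (row' ord0 M).
Proof. by move=> SM k; rewrite row_behead; exact: SM. Qed.

End Sequences.

(** * Orbits and running maxima *)

Lemma orbit_toS (T : Type) (n : nat) (step : 'I_n -> T -> T) (x : T)
    (k : 'I_n) :
  orbit_to step x k.+1 = step k (orbit_to step x k).
Proof. by rewrite /= insubT//= => kn; congr (step _ _); exact: val_inj. Qed.

(** Covers ranks past the horizon too, where both orbits are frozen, so that trajectories can be
    compared as functions on [nat]. *)
Lemma orbit_to_shift (T : Type) (n : nat) (step : 'I_n.+1 -> T -> T) (x : T)
    (k : nat) :
  orbit_to step x k.+1 =
  orbit_to (fun i => step (lift ord0 i)) (step ord0 x) k.
Proof.
elim: k => [|k IH]; first exact: (orbit_toS T n.+1 step x ord0).
have [kn|nk] := ltnP k n; last first.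
  by rewrite /= in IH *; rewrite IH !insubN -?leqNgt.
rewrite (orbit_toS T n.+1 step x (lift ord0 (Ordinal kn))).
have -> := orbit_toS T n (fun i => step (lift ord0 i)) (step ord0 x)
  (Ordinal kn).
by rewrite [orbit_to step _ _]IH.
Qed.

(** Moves the seed [g (X 0)] of [cost] outside and makes the terminal cost the seed, as in
    [run_cost]. *)
Lemma bigmax_seed {R : realType} (n : nat) (f : 'I_n -> R) (u v : R) :
  Num.max (\big[Num.max/u]_(k < n) f k) v =
  Num.max u (\big[Num.max/v]_(k < n) f k).
Proof.
elim: n f => [|n IH] f; first by rewrite !big_ord0.
by rewrite !big_ord_recl -maxA IH maxCA.
Qed.

Section Costs.
Context {R : realType} {d : nat} (g phi : 'rV[R]_d -> R).

(* Unlike cost, which is seeded with g (X 0), this satisfies the dynamic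
   programming recursion down to N = 0. *)
Definition run_cost (N : nat) (X : nat -> 'rV[R]_d) : R :=
  \big[Num.max/phi (X N)]_(k < N) g (X k).

Lemma run_costS N X :
  run_cost N.+1 X = Num.max (g (X 0%N)) (run_cost N (X \o S)).
Proof. by rewrite /run_cost big_ord_recl. Qed.

Lemma cost_run_cost N X :
  cost N g phi X = Num.max (g (X 0%N)) (run_cost N X).
Proof. by rewrite /cost bigmax_seed. Qed.

End Costs.

(** * Borel sets and countably valued Borel functions *)

Definition borel_set {X : ptopologicalType} (E : set X) : Prop :=
  @measurable _ (g_sigma_algebraType (@open X)) E.

Lemma borel_set_open {X : ptopologicalType} (E : set X) :
  open E -> borel_set E.
Proof. exact: sub_sigma_algebra. Qed.

Lemma borel_set_closed {X : ptopologicalType} (E : set X) :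
  closed E -> borel_set E.
Proof.
move=> cE; rewrite -(setCK E); apply: measurableC.
by apply: borel_set_open; exact: closed_openC.
Qed.

(** Open sets generate the target sigma-algebra, and the trace on [D] of the preimage of an open set
    is the trace of an open set. The premise [mD] comes from unfolding [measurable_fun]. *)
Lemma within_continuous_borel_fun {X Y : ptopologicalType} (D : set X)
    (f : X -> Y) : {within D, continuous f} -> borel_fun D f.
Proof.
move=> /continuousP cf mD.
apply: (@measurability _ _ (g_sigma_algebraType (@open X))
  (g_sigma_algebraType (@open Y)) D f (@open Y) erefl _ mD).
move=> _ [U oU <-]; have /open_subspaceP[V oV VD] := cf U oU.
rewrite setIC -[_ `&` D]VD.
by apply: measurableI => //; exact: borel_set_open.
Qed.

(** Within [D], the preimage of [U] is the countable union of the level sets of [idx] at those [i]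
    with [v i] in [U]. *)
Lemma borel_fun_countable {X Y : ptopologicalType} {I : countType}
    (D : set X) (idx : X -> I) (v : I -> Y) (f : X -> Y) :
  (forall x, D x -> f x = v (idx x)) ->
  (borel_set D -> forall i, borel_set (D `&` idx @^-1` [set i])) ->
  borel_fun D f.
Proof.
move=> fE mI mD U _.
have -> : D `&` f @^-1` U =
    \bigcup_i (if v i \in U then D `&` idx @^-1` [set i] else set0).
  apply/seteqP; split=> [x [Dx Ux]|x [i _]].
    by exists (idx x) => //; rewrite mem_set -?fE.
  case: ifPn => // /set_mem Ui [Dx /= ix].
  by split => //=; rewrite fE// ix.
apply: countable_bigcupT_measurable; first exact: countableP.
by move=> i; case: ifP => _; [exact: mI | exact: measurable0].
Qed.

Lemma borel_set_sublevel {R : realType} {X : ptopologicalType} (D : set X)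
    (u : X -> R) (c : R) : {within D, continuous u} -> borel_set D ->
  borel_set (D `&` [set x | u x < c]).
Proof.
move=> cu mD; apply: (within_continuous_borel_fun _ _ cu mD [set r | r < c]).
by apply: borel_set_open; exact: open_lt.
Qed.

Lemma first_index {T : Type} (D : set T) (P : nat -> T -> bool) :
  (forall x, D x -> exists i, P i x) -> exists idx : T -> nat,
  forall x, D x -> P (idx x) x /\ forall j, P j x -> (idx x <= j)%N.
Proof.
move=> ex; have /choice[idx] : forall x, exists i, D x ->
    P i x /\ forall j, P j x -> (i <= j)%N.
  (* Outside [D] the index 0 is an arbitrary filler. *)
  move=> x; have [Dx|nDx] := pselect (D x); last by exists 0%N.
  by case: (ex_minnP (ex x Dx)) => i Pi le; exists i.
by exists idx.
Qed.

(** By minimality, [idx] equals [i] exactly where [P i] holds and no earlier [P j] does: a Borel set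
    minus finitely many others. *)
Lemma first_index_borel {X : ptopologicalType} (D : set X)
    (P : nat -> X -> bool) (idx : X -> nat) :
  (forall x, D x -> P (idx x) x /\ forall j, P j x -> (idx x <= j)%N) ->
  (forall i, borel_set (D `&` [set x | P i x])) ->
  forall i, borel_set (D `&` idx @^-1` [set i]).
Proof.
move=> hidx mP i.
have -> : D `&` idx @^-1` [set i] = (D `&` [set x | P i x]) `\`
    \bigcup_(j in `I_i) (D `&` [set x | P j x]).
  apply/seteqP; split=> [x [Dx /= <-]|x [[Dx /= Pi] nPj]].
    have [Px le] := hidx x Dx; split => // -[j /= ji [_ /le]].
    by rewrite leqNgt ji.
  have [Px le] := hidx x Dx; split => //=.
  apply/eqP; rewrite eqn_leq le//= leqNgt; apply/negP => ltx.
  by apply: nPj; exists (idx x).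
by apply: measurableD; [exact: mP | apply: bigcup_measurable => j _; exact: mP].
Qed.

(** * Trajectories, value functions and their continuity *)

Section Game.
Context {R : realType} {d nA nB : nat}.
Context (A : set 'rV[R]_nA) (B : set 'rV[R]_nB).
Context (F : 'rV[R]_d * 'rV[R]_nA * 'rV[R]_nB -> 'rV[R]_d).
Context (g phi : 'rV[R]_d -> R).

Lemma traj_cons n x (a0 : 'rV[R]_nA) (b0 : 'rV[R]_nB)
    (a : 'M[R]_(n, nA)) (b : 'M[R]_(n, nB)) :
  traj F x (col_mx a0 a : 'M[R]_(n.+1, nA))
    (col_mx b0 b : 'M[R]_(n.+1, nB)) \o S =
  traj F (F (x, a0, b0)) a b.
Proof.
apply/funext => k; rewrite /traj [LHS]orbit_to_shift !row_cons0.
by congr orbit_to; apply/funext => i; rewrite !row_consS.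
Qed.

Lemma ftraj_cons n x (al : 'I_n.+1 -> 'rV[R]_d * 'rV[R]_nB -> 'rV[R]_nA)
    (b0 : 'rV[R]_nB) (b : 'M[R]_(n, nB)) :
  ftraj F x al (col_mx b0 b : 'M[R]_(n.+1, nB)) \o S =
  ftraj F (F (x, al ord0 (x, b0), b0)) (fun k => al (lift ord0 k)) b.
Proof.
apply/funext => k; rewrite /ftraj [LHS]orbit_to_shift !row_cons0.
by congr orbit_to; apply/funext => i; apply/funext => y; rewrite !row_consS.
Qed.

(** The function w_n of dynamic programming; [n] counts the steps still to be played. *)
Fixpoint value (n : nat) (y : 'rV[R]_d) : R :=
  if n is n'.+1 then
    Num.max (g y) (set_max [set set_min [set value n' (F (y, a, b)) | a in A]
                           | b in B])
  else phi y.

(** The inner minimum of [value n.+1], taken on pairs so that it can be jointly continuous in the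
    state and the opponent's move. *)
Definition reply_value (n : nat) (p : 'rV[R]_d * 'rV[R]_nB) : R :=
  set_min [set value n (F (p.1, a, p.2)) | a in A].

Context (A0 : A !=set0) (cA : compact A) (B0 : B !=set0) (cB : compact B).
Context (cF : {within setT `*` A `*` B, continuous F}).
Context (cg : continuous g) (cphi : continuous phi).

(** The variables are regrouped as [((y, b), a)], which puts the control [a] in the place of the
    parameter of [marginal_min_continuous]. *)
Let continuous_step (w : 'rV[R]_d -> R) : continuous w ->
  {within (setT `*` B) `*` A,
     continuous (fun q : ('rV[R]_d * 'rV[R]_nB) * 'rV[R]_nA =>
                   w (F (q.1.1, q.2, q.1.2)))}.
Proof.
move=> cw.
have -> : (fun q : ('rV[R]_d * 'rV[R]_nB) * 'rV[R]_nA =>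
    w (F (q.1.1, q.2, q.1.2))) = w \o (F \o (fun q => (q.1.1, q.2, q.1.2))).
  by [].
apply: (within_continuous_mapsto _ setT) => //;
  last exact: continuous_subspaceT.
apply: (within_continuous_mapsto _ _ _ _ _ _ cF).
  by move=> [[y b] a] [[_ Bb] Aa].
have fst_c (U V : topologicalType) : continuous (@fst U V).
  by move=> p; exact: cvg_fst.
have snd_c (U V : topologicalType) : continuous (@snd U V).
  by move=> p; exact: cvg_snd.
apply: within_continuous_pair; last first.
  apply: continuous_subspaceT => q.
  by apply: (continuous_comp (f := fst)); [exact: fst_c|exact: snd_c].
apply: within_continuous_pair; last exact/continuous_subspaceT/snd_c.
apply: continuous_subspaceT => q.
by apply: (continuous_comp (f := fst)); [exact: fst_c|exact: fst_c].
Qed.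

(** From here to [max_attained], continuity of [value n] is a premise, because these facts feed the
    induction that proves [value_continuous]. *)
Lemma continuous_reply_section n y b : continuous (value n) -> B b ->
  {within A, continuous (fun a => value n (F (y, a, b)))}.
Proof.
move=> cw Bb.
apply: (within_continuous_mapsto _ _ (fun a => ((y, b), a)) _ _ _
  (continuous_step _ cw)) => //.
apply: within_continuous_pair; apply: continuous_subspaceT => a //.
exact: cst_continuous.
Qed.

Let reply_attained n y b : continuous (value n) -> B b ->
  (exists2 a, A a & reply_value n (y, b) = value n (F (y, a, b))) /\
  (forall a, A a -> reply_value n (y, b) <= value n (F (y, a, b))).
Proof.
by move=> cw Bb; apply: set_min_attained => //; exact: continuous_reply_section.
Qed.

Let continuous_reply n : continuous (value n) ->
  {within setT `*` B, continuous (reply_value n)}.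
Proof.
move=> cw.
apply: (marginal_min_continuous _ _ _ _ cA (continuous_step _ cw)).
- by move=> [y b] [_ Bb]; have [] := reply_attained n y b cw Bb.
- by move=> [y b] a [_ Bb]; have [_] := reply_attained n y b cw Bb; apply.
Qed.

Let max_attained n y : continuous (value n) ->
  (exists2 b, B b & set_max [set reply_value n (y, b) | b in B] =
                    reply_value n (y, b)) /\
  (forall b, B b -> reply_value n (y, b) <=
                    set_max [set reply_value n (y, b) | b in B]).
Proof.
move=> cw; apply: set_max_attained => //.
apply: (within_continuous_mapsto _ _ (fun b => (y, b)) _ _ _
  (continuous_reply n cw)) => //.
apply: within_continuous_pair; apply: continuous_subspaceT => a //.
exact: cst_continuous.
Qed.

Lemma value_continuous n : continuous (value n).
Proof.
elim: n => [//|n cw].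
have cm : continuous (fun y => set_max [set reply_value n (y, b) | b in B]).
  apply/continuous_subspace_setT.
  apply: (marginal_max_continuous _ _ _ _ cB (continuous_reply n cw)).
  - by move=> y _; have [] := max_attained n y cw.
  - by move=> y b _; have [_] := max_attained n y cw; apply.
by move=> y; apply: (@continuous_max _ _ g _ y (cg y) (cm y)).
Qed.

(** * Optimality relations, the iterated max-min and the lower bound *)

Lemma reply_value_attained n y b : B b ->
  exists2 a, A a & reply_value n (y, b) = value n (F (y, a, b)).
Proof.
by move=> Bb; have [] := reply_attained n y b (value_continuous n) Bb.
Qed.

Lemma reply_value_le n y a b : A a -> B b ->
  reply_value n (y, b) <= value n (F (y, a, b)).
Proof.
move=> Aa Bb.
by have [_] := reply_attained n y b (value_continuous n) Bb; apply.
Qed.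

Lemma reply_value_continuous n :
  {within setT `*` B, continuous (reply_value n)}.
Proof. exact/continuous_reply/value_continuous. Qed.

Lemma value_attained n y :
  exists2 b, B b & value n.+1 y = Num.max (g y) (reply_value n (y, b)).
Proof.
by have [[b Bb e] _] := max_attained n y (value_continuous n); exists b => //=;
  rewrite -e.
Qed.

Lemma value_ge n y b : B b ->
  Num.max (g y) (reply_value n (y, b)) <= value n.+1 y.
Proof.
move=> Bb; rewrite /= le_max2//.
by have [_] := max_attained n y (value_continuous n); apply.
Qed.

(** The constant [c] stands for the maximum accumulated in the past: peeling off one stage replaces
    it by [Num.max c (g y)], which keeps the induction going. *)
Lemma maxmin_run_cost n (c : R) y :
  maxmin A B (fun (a : 'M[R]_(n, nA)) b =>
    Num.max c (run_cost g phi n (traj F y a b))) = Num.max c (value n y).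
Proof.
elim: n c y => [|n IH] c y /=; first by rewrite /run_cost big_ord0.
pose tail (a0 : 'rV[R]_nA) (b0 : 'rV[R]_nB) : R :=
  maxmin A B (fun (a : 'M[R]_(n, nA)) b => Num.max c
    (run_cost g phi n.+1 (traj F y (col_mx a0 a : 'M[R]_(n.+1, nA))
                                   (col_mx b0 b : 'M[R]_(n.+1, nB))))).
have step a0 b0 :
    tail a0 b0 = Num.max (Num.max c (g y)) (value n (F (y, a0, b0))).
  rewrite -IH; congr maxmin; apply/funext => a; apply/funext => b.
  by rewrite run_costS traj_cons maxA.
have inner b0 : B b0 -> set_min [set tail a0 b0 | a0 in A] =
    Num.max (Num.max c (g y)) (reply_value n (y, b0)).
  move=> Bb0; apply: set_minE.
    have [a Aa ->] := reply_value_attained n y b0 Bb0.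
    by exists a => //; rewrite step.
  move=> _ [a Aa <-]; rewrite step le_max2//; exact: reply_value_le.
apply: set_maxE.
  have [b Bb e] := value_attained n y; exists b => //.
  by rewrite inner// -maxA -e.
move=> _ [b Bb <-]; rewrite inner// -maxA le_max2//; exact: value_ge.
Qed.

(** The opponent opens with a maximizing [b0]. Non-anticipativity fixes the reply [a0] before the
    rest of [b] is known, and the rest of [alpha] is again a non-anticipative strategy, started at
    [F (x, a0, b0)]. *)
Lemma nonanticipative_lower_bound n x (alpha : 'M[R]_(n, nB) -> 'M[R]_(n, nA)) :
  (forall b, seqs B b -> seqs A (alpha b)) -> nonanticipative B alpha ->
  exists2 b, seqs B b & value n x <= run_cost g phi n (traj F x (alpha b) b).
Proof.
elim: n x alpha => [|n IH] x alpha alA na.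
  exists 0; first by case.
  by rewrite /run_cost big_ord0.
have [b0 Bb0 e] := value_attained n x; rewrite e {e}.
(* Repeating [b0] only fills the tail with moves in [B]; [al0] shows that every other tail in [B]
   yields the same reply. *)
pose a0 := row ord0 (alpha (col_mx b0 (\matrix_(k < n) b0))).
have Bc : seqs B (\matrix_(k < n) b0) by move=> k; rewrite rowK.
have Aa0 : A a0 by apply: alA; exact: seqs_cons.
have al0 b : seqs B b -> row ord0 (alpha (col_mx b0 b)) = a0.
  move=> Bb; apply: na; [exact: seqs_cons..|].
  by move=> j; rewrite leqn0 => /eqP j0; rewrite (_ : j = ord0) ?row_cons0//;
    exact: val_inj.
pose alpha' (b : 'M[R]_(n, nB)) : 'M[R]_(n, nA) :=
  row' ord0 (alpha (col_mx b0 b)).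
have [b Bb le] : exists2 b, seqs B b & value n (F (x, a0, b0)) <=
    run_cost g phi n (traj F (F (x, a0, b0)) (alpha' b) b).
  apply: IH => [b Bb|k b b' Bb Bb' bb'].
    by apply: seqs_behead; apply: alA; exact: seqs_cons.
  (* Rank [k] of [alpha'] is rank [k + 1] of [alpha]: tails agreeing up to [k], behind the common
     head [b0], agree up to [k + 1]. *)
  rewrite !row_behead; apply: na; [exact: seqs_cons..|] => j.
  case: (unliftP ord0 j) => [i|] -> jk; last by rewrite !row_cons0.
  by rewrite !row_consS bb'.
exists (col_mx b0 b); first exact: seqs_cons.
rewrite -[alpha _]cons_behead al0// run_costS traj_cons.
apply: le_max2 => //.
by apply: le_trans le; exact: reply_value_le.
Qed.

(** * Strategies induced by feedbacks, near-optimal Borel feedbacks and the upper bound *)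

Definition feedback_strategy n x
    (al : 'I_n -> 'rV[R]_d * 'rV[R]_nB -> 'rV[R]_nA) (b : 'M[R]_(n, nB)) :
    'M[R]_(n, nA) :=
  \matrix_(k < n) al k (ftraj F x al b k, row k b).

Lemma traj_feedback_strategy n x al (b : 'M[R]_(n, nB)) :
  traj F x (feedback_strategy n x al b) b = ftraj F x al b.
Proof.
apply/funext; elim=> [//|k IH]; rewrite /traj /ftraj /= in IH *.
by case: insubP => [i _ ik|_]; rewrite IH// rowK /ftraj ik.
Qed.

(** The inequality is strict because the state of rank [k] is reached before move [k]; the control
    of rank [k] also reads [row k b]. *)
Lemma ftraj_nonanticipative n x al (b b' : 'M[R]_(n, nB)) k :
  (forall j : 'I_n, (j < k)%N -> row j b = row j b') ->
  ftraj F x al b k = ftraj F x al b' k.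
Proof.
elim: k => [//|k IH] bb'; have {}IH := IH (fun j jk => bb' j (ltnW jk)).
rewrite /ftraj /= in IH *.
by case: insubP => [i _ ik|_]; rewrite IH// bb'// ik.
Qed.

Lemma feedback_strategy_nonanticipative n x al :
  nonanticipative B (feedback_strategy n x al).
Proof.
move=> k b b' _ _ bb'; rewrite !rowK bb'//.
by rewrite (ftraj_nonanticipative n x al b b' k)// => j /ltnW; exact: bb'.
Qed.

(** After move [k], [n - k.+1] steps remain, a count that dropping the first feedback preserves.
    Each step loses at most [e], and the losses add up. *)
Lemma feedback_upper_bound n x (al : 'I_n -> 'rV[R]_d * 'rV[R]_nB -> 'rV[R]_nA)
    (e : R) :
  0 <= e ->
  (forall (k : 'I_n) y b, B b -> value (n - k.+1) (F (y, al k (y, b), b)) <=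
                        reply_value (n - k.+1) (y, b) + e) ->
  forall b, seqs B b -> run_cost g phi n (ftraj F x al b) <= value n x + e *+ n.
Proof.
move=> e0; elim: n x al => [|n IH] x al opt b Bb.
  by rewrite /run_cost big_ord0 addr0.
rewrite -(cons_behead _ b) run_costS ftraj_cons.
set b0 := row ord0 b; have Bb0 : B b0 by exact: Bb.
have gv := value_ge n x b0 Bb0; rewrite ge_max in gv.
have /andP[gx rv] := gv.
rewrite ge_max; apply/andP; split.
  by rewrite (le_trans gx)// lerDl mulrn_wge0.
apply: (le_trans (IH _ (fun k => al (lift ord0 k)) _ _ _)).
- by move=> k y b1; exact: opt (lift ord0 k) y b1.
- exact: seqs_behead.
rewrite mulrS addrA lerD2r (le_trans _ (_ : reply_value n (x, b0) + e <= _))//.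
  by have := opt ord0 x b0 Bb0; rewrite subn1.
by rewrite lerD2r.
Qed.

(** The loss [gap i] from playing [s i] is continuous in [(y, b)], so the sets where it is below [e]
    are Borel. By density they cover the domain, and [idx] picks the first one containing the
    point. *)
Lemma near_optimal_reply n (s : nat -> 'rV[R]_nA) (e : R) :
  (forall i, A (s i)) ->
  (forall a U, A a -> nbhs a U -> exists i, U (s i)) -> 0 < e ->
  exists idx : 'rV[R]_d * 'rV[R]_nB -> nat,
    (forall y b, B b ->
      value n (F (y, s (idx (y, b)), b)) <= reply_value n (y, b) + e) /\
    (borel_set ([set: 'rV[R]_d] `*` B) ->
      forall i, borel_set (([set: 'rV[R]_d] `*` B) `&` idx @^-1` [set i])).
Proof.
move=> As dense e0.
pose gap i (p : 'rV[R]_d * 'rV[R]_nB) :=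
  value n (F (p.1, s i, p.2)) - reply_value n p.
have cgap i : {within [set: 'rV[R]_d] `*` B, continuous (gap i)}.
  move=> p; apply: within_continuousB; last exact: reply_value_continuous.
  apply: (within_continuous_mapsto _ _ (fun p => (p, s i)) _ _ _
    (continuous_step _ (value_continuous n))).
    by move=> q Bq; split => //; exact: As.
  apply: within_continuous_pair; apply: continuous_subspaceT => q //.
  exact: cst_continuous.
have [|idx hidx] := first_index ([set: 'rV[R]_d] `*` B)
    (fun i p => gap i p < e).
  move=> [y b] [_ Bb]; have [a Aa ra] := reply_value_attained n y b Bb.
  (* Density is used at an exact minimizer [a]: by continuity on [A], a term [s i] close enough to
     [a] loses less than [e]. *)
  have /subspace_continuousP/(_ a Aa)/cvgrPdist_lt/(_ e e0) :=
    continuous_reply_section n y b (value_continuous n) Bb.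
  rewrite /within /= => /(dense a _ Aa)[i /(_ (As i))].
  rewrite /from_subspace ltr_distlC => /andP[_ lt]; exists i.
  by rewrite /gap /= ra ltrBlDl.
exists idx; split=> [y b Bb|mD].
  have [+ _] := hidx (y, b) (conj I Bb).
  by rewrite /gap ltrBlDl => /ltW.
apply: (first_index_borel _ _ _ hidx) => i.
exact: borel_set_sublevel.
Qed.

Lemma traj_continuous n x (a : 'M[R]_(n, nA)) k : seqs A a ->
  {within @seqs R n nB B, continuous (fun b => traj F x a b k)}.
Proof.
move=> Aa; elim: k => [|k IH].
  by apply: continuous_subspaceT => b; exact: cst_continuous.
rewrite /traj /= in IH *.
case: insubP => [i _ _|_] //=.
apply: (within_continuous_mapsto _ _
  (fun b => (traj F x a b k, row i a, row i b)) _ _ _ cF).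
  by move=> b Bb; split; [split|] => //=; exact: Aa.
apply: within_continuous_pair; last exact/continuous_subspaceT/row_continuous.
apply: within_continuous_pair; first exact: IH.
by apply: continuous_subspaceT => b; exact: cst_continuous.
Qed.

(* Where the countably valued feedbacks take prescribed values, the controls are
   fixed, hence the states are continuous in b. This avoids relating the Borel
   sets of a product to the product of the Borel sigma-algebras. *)
Lemma feedback_strategy_borel n x (s : nat -> 'rV[R]_nA)
    (idx : 'I_n -> 'rV[R]_d * 'rV[R]_nB -> nat) :
  (forall i, A (s i)) ->
  (forall k i,
     borel_set (([set: 'rV[R]_d] `*` B) `&` idx k @^-1` [set i])) ->
  borel_fun (seqs B) (feedback_strategy n x (fun k p => s (idx k p))).
Proof.
move=> As midx.
set al := fun k p => s (idx k p).
pose v (t : {ffun 'I_n -> nat}) : 'M[R]_(n, nA) := \matrix_k s (t k).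
pose ix b := [ffun k : 'I_n => idx k (ftraj F x al b k, row k b)].
have alE b : feedback_strategy n x al b = v (ix b).
  by apply/row_matrixP => k; rewrite !rowK ffunE.
apply: (borel_fun_countable _ ix v) => // mD t.
pose h (k : 'I_n) b : 'rV[R]_d * 'rV[R]_nB := (traj F x (v t) b k, row k b).
have vt : seqs A (v t) by move=> k; rewrite rowK.
have -> : seqs B `&` ix @^-1` [set t] = seqs B `&` \bigcap_(k in setT)
    (seqs B `&` h k @^-1` (([set: 'rV[R]_d] `*` B) `&` idx k @^-1` [set t k])).
  apply/seteqP; split=> [b [Bb /= bt]|b [Bb /= bt]].
    split => // k _; split => //; split; first by split => //; exact: Bb.
    by rewrite /h /= -bt -alE traj_feedback_strategy ffunE.
  split => //=; apply/ffunP => k; rewrite ffunE.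
  have bk i : idx i (h i b) = t i by have [_ []] := bt i I.
  suff -> : ftraj F x al b k = traj F x (v t) b k by exact: bk.
  (* Induction on the rank: at equal states, [bk] makes the feedback play [s (t i)], which is row
     [i] of [v t]. *)
  move: (k : nat) => {k}; elim=> [//|k IH]; rewrite /traj /ftraj /= in IH *.
  case: insubP => [i _ ik|_]; rewrite IH//.
  by rewrite rowK /al -(bk i) /h /traj ik.
apply: measurableI => //; apply: fin_bigcap_measurable => [|k _].
  exact: finite_finset.
apply: (within_continuous_borel_fun _ (h k) _ mD); last exact: midx.
apply: within_continuous_pair; first exact: traj_continuous.
exact/continuous_subspaceT/row_continuous.
Qed.

Lemma near_optimal_feedback n (e : R) : 0 < e ->
  exists al : 'I_n -> 'rV[R]_d * 'rV[R]_nB -> 'rV[R]_nA,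
  [/\ forall k, feedbacks A B (al k),
      forall x, strategies A B (feedback_strategy n x al) &
      forall x b, seqs B b ->
        run_cost g phi n (ftraj F x al b) <= value n x + e].
Proof.
move=> e0.
have [s [As dense]] := countable_dense_seq A A0 cA.
(* The total loss is [n] times [e'], hence at most [e]; dividing by [n.+1] also covers [n = 0]. *)
pose e' := e / n.+1%:R.
have e'0 : 0 < e' by rewrite divr_gt0.
have /choice[idx hidx] := fun k : 'I_n =>
  near_optimal_reply (n - k.+1) s e' As dense e'0.
(* Compact subsets of a Hausdorff space are closed, and the domain is the preimage of [B] under a
   continuous projection. *)
have mB : borel_set ([set: 'rV[R]_d] `*` B).
  rewrite (_ : _ `*` _ = snd @^-1` B); last first.
    by apply/seteqP; split => [p []|p].
  apply: borel_set_closed; apply: preimage_closed.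
    by move=> p _; exact: cvg_snd.
  by apply: compact_closed => //; exact: norm_hausdorff.
have midx k i := (hidx k).2 mB i.
exists (fun k p => s (idx k p)); split=> [k|x|x b Bb].
- split => [y b _|]; first exact: As.
  by apply: (borel_fun_countable _ (idx k) s) => // _; exact: midx.
- split=> [b Bb k||].
  + by rewrite rowK; exact: As.
  + exact: feedback_strategy_borel.
  + exact: feedback_strategy_nonanticipative.
- apply: le_trans (feedback_upper_bound n x _ e' (ltW e'0) _ b Bb) _.
    by move=> k y b' Bb'; exact: (hidx k).1.
  rewrite lerD2l -mulr_natr mulrAC ler_pdivrMr// ler_pM2l// ler_nat.
  exact: leqnSn.
Qed.

(** * Identification of the three values *)

Let V n x := Num.max (g x) (value n x).

(** The seed of [cost] is the initial accumulated maximum [c = g x]. For [n >= 1] it is already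
    contained in [value n x]. *)
Lemma Vbar0_value n x : Vbar0 n A B F g phi x = V n x.
Proof.
rewrite /V -maxmin_run_cost; congr maxmin.
by apply/funext => a; apply/funext => b; rewrite /J0 cost_run_cost.
Qed.

(** Upper bound: the strategy induced by a near-optimal feedback competes in the infimum, for every
    [e > 0]. Lower bound: every strategy meets an opponent forcing [value n x]. *)
Lemma V0_value n x : V0 n A B F g phi x = (V n x)%:E.
Proof.
apply/eqP; rewrite eq_le; apply/andP; split.
  apply/lee_addgt0Pr => e e0.
  have [al [_ sal le]] := near_optimal_feedback n e e0.
  apply: (@le_trans _ _ (ereal_sup
      [set (J0 F g phi x (feedback_strategy n x al b) b)%:E | b in seqs B])).
    by apply: ereal_inf_lbound; exists (feedback_strategy n x al).
  apply: ge_ereal_sup => _ [b Bb <-].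
  rewrite -EFinD lee_fin /J0 cost_run_cost traj_feedback_strategy.
  rewrite ge_max; apply/andP; split.
    by apply: (@le_trans _ _ (V n x)); rewrite ?le_max ?lexx// lerDl ltW.
  by rewrite (le_trans (le x b Bb))// lerD2r le_max lexx orbT.
apply: le_ereal_inf_tmp => _ [al [alA _ na] <-].
have [b Bb le] := nonanticipative_lower_bound n x al alA na.
apply: (@le_trans _ _ (J0 F g phi x (al b) b)%:E).
  by rewrite lee_fin /J0 cost_run_cost le_max2.
by apply: ereal_sup_ubound; exists b.
Qed.

Lemma Vtilde0_value n x : Vtilde0 n A B F g phi x = (V n x)%:E.
Proof.
apply/eqP; rewrite eq_le; apply/andP; split.
  apply/lee_addgt0Pr => e e0.
  have [al [fal _ le]] := near_optimal_feedback n e e0.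
  apply: (@le_trans _ _ (ereal_sup
      [set (Jtilde0 F g phi x al b)%:E | b in seqs B])).
    by apply: ereal_inf_lbound; exists al.
  apply: ge_ereal_sup => _ [b Bb <-].
  rewrite -EFinD lee_fin /Jtilde0 cost_run_cost.
  rewrite ge_max; apply/andP; split.
    by apply: (@le_trans _ _ (V n x)); rewrite ?le_max ?lexx// lerDl ltW.
  by rewrite (le_trans (le x b Bb))// lerD2r le_max lexx orbT.
apply: le_ereal_inf_tmp => _ [al fal <-].
have alA b : seqs B b -> seqs A (feedback_strategy n x al b).
  by move=> Bb k; rewrite rowK; apply: (fal k).1; exact: Bb.
(* The opponent answers the induced strategy, whose trajectory is that of the feedback itself. *)
have [b Bb le] := nonanticipative_lower_bound n x _ alA
  (feedback_strategy_nonanticipative n x al).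
apply: (@le_trans _ _ (Jtilde0 F g phi x al b)%:E).
  by rewrite lee_fin /Jtilde0 cost_run_cost -traj_feedback_strategy le_max2.
by apply: ereal_sup_ubound; exists b.
Qed.

End Game.

Theorem theorem2p3 (R : realType) (N d nA nB : nat)
    (A : set 'rV[R]_nA) (B : set 'rV[R]_nB)
    (F : 'rV[R]_d * 'rV[R]_nA * 'rV[R]_nB -> 'rV[R]_d)
    (g phi : 'rV[R]_d -> R) :
  (1 <= N)%N -> (1 <= nA)%N -> (1 <= nB)%N ->
  A !=set0 -> compact A -> B !=set0 -> compact B ->
  {within setT `*` A `*` B, continuous F} ->
  lipschitz (g : 'rV[R]_d -> R^o) -> lipschitz (phi : 'rV[R]_d -> R^o) ->
  forall x : 'rV[R]_d,
    V0 N A B F g phi x = (Vbar0 N A B F g phi x)%:E /\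
    (Vbar0 N A B F g phi x)%:E = Vtilde0 N A B F g phi x.
Proof.
move=> _ _ _ A0 cA B0 cB cF.
move=> /lipschitz_continuous cg /lipschitz_continuous cphi x.
by rewrite V0_value// Vbar0_value// Vtilde0_value.
Qed.
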